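(* Let $G$ be a finite group acting on a connected space $X$ with $S=\operatorname{Sing}_G(X)=\bigcup_{g\neq e}X^g$ finite, and let $T\subseteq X$ be a finite $G$-invariant subset. Let $\mathcal{O}(T)$ and $\mathcal{O}(S)$ denote the sets of $G$-orbits in $T$ and $S$. Then there is a natural $\Sigma_n[G]$-equivariant embedding of posets $\mathcal{P}^T_n(G,X)\hookrightarrow\mathcal{D}_n(G,T\cup S)$ whose image consists of all pairs $(\tilde\beta,z)$ such that $|z^{-1}(o)|\neq1$ for every $o\in\mathcal{O}(S)\setminus\mathcal{O}(T)$.
   Context: ''Space'' means a CW complex or algebraic variety over an algebraically closed field. $\mathcal{A}^T_n(G,X)$ is the arrangement in $X^n$ of the subspaces $H_{ij}(g)=\{x:g.x_i=x_j\}$ ($1\leq i<j\leq n$, $g\in G$) and $H_i^t=\{x:x_i=t\}$ ($1\leq i\leq n$, $t\in T$). Its layers are the connected components of intersections of subfamilies (empty intersection $=X^n$), and $\mathcal{P}^T_n(G,X)$ is the poset of layers under reverse inclusion. $\Sigma_n[G]=G^n\rtimes\Sigma_n$ acts on $X^n$ by $(g_1,\dots,g_n,\sigma)\cdot x$ having $\sigma(i)$-th entry $g_i.x_i$, and hence on layers. For a finite $G$-set $U$: a projectivized $G$-coloring of a finite set $B$ is an equivalence class of $b:B\to G$ with $b\sim bg$; a partial $G$-partition $\tilde\beta$ of $[n]$ is a partition $\beta$ of a subset of $[n]$ into nonempty blocks each with a projectivized $G$-coloring, zero block $Z=[n]\setminus\bigcup B$; $\mathcal{D}_n(G,U)$ is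 the set of pairs $(\tilde\beta,z)$, $z:Z\to U$, ordered by the order generated by (merge) $(\tilde\beta\cup\{\tilde A,\tilde B\},z)\prec(\tilde\beta\cup\{\tilde C\},z)$ with $C=A\cup B$, $c=a\cup bg$ for some $g\in G$, and (color) $(\tilde\beta\cup\{\tilde B\},z)\prec(\tilde\beta,z')$ with $z'|_Z=z$, $z'|_B=f\circ b$ for a $G$-equivariant $f:G\to U$; $\Sigma_n[G]$ acts by blocks $\sigma(B)$ colored by $b'(\sigma(j))=g_jb(j)$ and zero coloring $z'(\sigma(j))=g_j.z(j)$.
   Formalization: The formal theorem assumes that the connected space X has at least two points; for X a single point (G trivial, T empty, n = 2) there is one layer, but two elements of D_n satisfy the image condition, so the claim fails. *)

(* Defs.v *)
From HB Require Import structures.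
From mathcomp Require Import all_boot all_order all_fingroup all_algebra.
From mathcomp Require Import all_classical all_reals all_analysis.
From mathcomp Require mpoly.
From Stdlib Require Import Relation_Operators.

Set Implicit Arguments.
Unset Strict Implicit.
Unset Printing Implicit Defensive.

Import GRing.Theory numFieldNormedType.Exports.
Local Open Scope classical_set_scope.
Local Open Scope ring_scope.

Definition disk (R : realType) (d : nat) : set 'rV[R]_d :=
  [set v : 'rV[R]_d | \sum_i v ord0 i ^+ 2 <= 1].
Definition open_disk (R : realType) (d : nat) : set 'rV[R]_d :=
  [set v : 'rV[R]_d | \sum_i v ord0 i ^+ 2 < 1].
Definition sphere (R : realType) (d : nat) : set 'rV[R]_d :=
  [set v : 'rV[R]_d | \sum_i v ord0 i ^+ 2 = 1].

(* The characteristic maps are total functions of which only the values on the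
   closed disk matter.  [cw_weak]: a set is closed as soon as its inverse image
   in each closed disk is closed. *)
Record cwComplex (R : realType) := CWComplex {
  cw_space :> topologicalType;
  cw_hausdorff : hausdorff_space cw_space;
  cw_cell : Type;
  cw_dim : cw_cell -> nat;
  cw_char : forall e : cw_cell, 'rV[R]_(cw_dim e) -> cw_space;
  cw_continuous : forall e, {within @disk R (cw_dim e), continuous (@cw_char e)};
  cw_injective : forall e (u v : 'rV[R]_(cw_dim e)),
    open_disk u -> open_disk v -> cw_char u = cw_char v -> u = v;
  cw_disjoint : forall e e', e <> e' ->
    (@cw_char e @` @open_disk R (cw_dim e)) `&`
    (@cw_char e' @` @open_disk R (cw_dim e')) = set0;
  cw_cover : forall x, exists e, (@cw_char e @` @open_disk R (cw_dim e)) x;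
  cw_closure_finite : forall e, exists s : set cw_cell,
    [/\ finite_set s, forall a, s a -> (cw_dim a < cw_dim e)%N &
        @cw_char e @` @sphere R (cw_dim e) `<=`
        \bigcup_(a in s) (@cw_char a @` @open_disk R (cw_dim a))];
  cw_weak : forall A : set cw_space,
    (forall e, closed (@disk R (cw_dim e) `&` @cw_char e @^-1` A)) -> closed A
}.

(* A variety is given classically, by its set of points and a finite atlas of
   affine charts, i.e. bijections from subsets of the variety onto Zariski
   closed subsets of affine space, with regular transition maps and closed
   diagonal.  It need not be irreducible.  Padding with zero coordinates, all
   the charts take their values in one affine space [k^m]. *)

Definition peval (k : closedFieldType) (m : nat) (p : mpoly.mpoly m k)
  (v : 'rV[k]_m) : k := mpoly.meval (fun l => v ord0 l) p.

Definition algebraic_set (k : closedFieldType) (m : nat) (A : set 'rV[k]_m) :=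
  exists I : set (mpoly.mpoly m k),
    A = [set v | forall p, I p -> peval p v = 0].

Record variety (k : closedFieldType) := Variety {
  var_point : choiceType;
  var_ambient : nat;
  var_index : finType;
  chart_dom : var_index -> set var_point;
  chart : var_index -> var_point -> 'rV[k]_var_ambient;
  chart_cover : forall x, exists i, chart_dom i x;
  chart_inj : forall i x y, chart_dom i x -> chart_dom i y ->
    chart i x = chart i y -> x = y;
  chart_closed : forall i, algebraic_set (chart i @` chart_dom i);
  chart_open : forall i j, exists2 A : set 'rV[k]_var_ambient,
    algebraic_set A &
    chart i @` (chart_dom i `&` chart_dom j) = chart i @` chart_dom i `\` A;
  chart_regular : forall i j x0 l, chart_dom i x0 -> chart_dom j x0 ->
    exists p q : mpoly.mpoly var_ambient k, peval q (chart i x0) != 0 /\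
      forall x, chart_dom i x -> chart_dom j x -> peval q (chart i x) != 0 ->
        chart j x ord0 l = peval p (chart i x) / peval q (chart i x);
  chart_separated : forall i j,
    algebraic_set ((fun x => row_mx (chart i x) (chart j x)) @`
                   (chart_dom i `&` chart_dom j))
}.

(* Regular maps: near each point, and in charts, the map is defined and its
   coordinates are quotients of polynomials. *)
Definition regular_map (k : closedFieldType) (V W : variety k)
    (f : var_point V -> var_point W) : Prop :=
  forall (i : var_index V) (j : var_index W) (x0 : var_point V),
    chart_dom i x0 -> chart_dom j (f x0) ->
    exists q : mpoly.mpoly (var_ambient V) k, peval q (chart i x0) != 0 /\
      exists p : 'I_(var_ambient W) -> mpoly.mpoly (var_ambient V) k,
        forall x, chart_dom i x -> peval q (chart i x) != 0 ->
          chart_dom j (f x) /\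
          forall l, chart j (f x) ord0 l =
                    peval (p l) (chart i x) / peval q (chart i x).

(* The Zariski topology has for basis the principal open sets of the charts. *)
Definition principal_open (k : closedFieldType) (V : variety k) :
    set (set (var_point V)) :=
  [set D | exists (i : var_index V) (p : mpoly.mpoly (var_ambient V) k),
     D = [set x | chart_dom i x /\ peval p (chart i x) != 0]].

Definition zariski (k : closedFieldType) (V : variety k) : Type := var_point V.
HB.instance Definition _ (k : closedFieldType) (V : variety k) :=
  Choice.on (zariski V).
HB.instance Definition _ (k : closedFieldType) (V : variety k) :=
  isSubBaseTopological.Build (zariski V) (@principal_open k V) id.

(* The Zariski topology of the product variety [V^n]; it is finer than the
   product topology.  The charts of [V^n] are the products of [n] charts of
   [V], and [mxvec] identifies [n x m] matrices with points of [k^(n * m)]. *)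
Definition power_chart (k : closedFieldType) (V : variety k) (n : nat)
    (a : 'I_n -> var_index V) (x : 'I_n -> var_point V) :
    'rV[k]_(n * var_ambient V) :=
  mxvec (\matrix_(i < n, l < var_ambient V) chart (a i) (x i) ord0 l).

Definition power_principal_open (k : closedFieldType) (V : variety k)
    (n : nat) : set (set ('I_n -> var_point V)) :=
  [set D | exists (a : 'I_n -> var_index V)
                  (p : mpoly.mpoly (n * var_ambient V) k),
     D = [set x | (forall i, chart_dom (a i) (x i)) /\
                  peval p (power_chart a x) != 0]].

Definition zariski_power (k : closedFieldType) (V : variety k) (n : nat) : Type :=
  'I_n -> var_point V.
HB.instance Definition _ (k : closedFieldType) (V : variety k) (n : nat) :=
  Choice.copy (zariski_power V n) ('I_n -> var_point V).
HB.instance Definition _ (k : closedFieldType) (V : variety k) (n : nat) :=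
  isSubBaseTopological.Build (zariski_power V n)
    (@power_principal_open k V n) id.

Inductive space : Type :=
| CWSpace (R : realType) (X : cwComplex R)
| VarietySpace (k : closedFieldType) (V : variety k).

Definition space_point (X : space) : Type :=
  match X with
  | CWSpace _ X => cw_space X
  | VarietySpace _ V => var_point V
  end.

Definition connected_space (X : space) : Prop :=
  match X with
  | CWSpace _ X => connected [set: cw_space X]
  | VarietySpace _ V => connected [set: zariski V]
  end.

Definition space_morphism (X : space) : (space_point X -> space_point X) -> Prop :=
  match X with
  | CWSpace _ X => fun f => continuous (f : cw_space X -> cw_space X)
  | VarietySpace _ V => fun f => regular_map (f : var_point V -> var_point V)
  end.

(* The connected component of [x] in the subspace [A] of [X^n]. *)
Definition power_component (X : space) (n : nat) :
    set ('I_n -> space_point X) -> ('I_n -> space_point X) ->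
    set ('I_n -> space_point X) :=
  match X with
  | CWSpace _ X => fun A x =>
      @connected_component (prod_topology (fun _ : 'I_n => cw_space X)) A x
  | VarietySpace _ V => fun A x => @connected_component (zariski_power V n) A x
  end.

Definition is_left_action (G : finGroupType) (U : Type) (act : G -> U -> U) : Prop :=
  (forall x, act 1%g x = x) /\
  (forall g h x, act (g * h)%g x = act g (act h x)).

Record gset (G : finGroupType) := GSet {
  gcarrier :> Type;
  gact : G -> gcarrier -> gcarrier;
  gactP : is_left_action gact
}.

Definition equivariant (G : finGroupType) (U : gset G) (f : G -> U) : Prop :=
  forall g h, f (g * h)%g = gact g (f h).

Record gspace (G : finGroupType) := GSpace {
  gspace_space :> space;
  gspace_act : G -> space_point gspace_space -> space_point gspace_space;
  gspace_actP : is_left_action gspace_act;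
  gspace_act_morphism : forall g, space_morphism (gspace_act g)
}.

Definition gspace_gset (G : finGroupType) (X : gspace G) : gset G :=
  GSet (gspace_actP X).

Definition G_invariant (G : finGroupType) (U : gset G) (A : set U) : Prop :=
  forall g x, A x -> A (gact g x).

Definition G_orbit (G : finGroupType) (U : gset G) (x : U) : set U :=
  range (fun g : G => gact g x).

Definition G_orbits (G : finGroupType) (U : gset G) (A : set U) : set (set U) :=
  [set G_orbit x | x in A].

Definition fixed_points (G : finGroupType) (U : gset G) (g : G) : set U :=
  [set x | gact g x = x].

Definition Sing (G : finGroupType) (U : gset G) : set U :=
  \bigcup_(g in [set g : G | g != 1%g]) @fixed_points G U g.

Lemma Sing_invariant (G : finGroupType) (U : gset G) : G_invariant (@Sing G U).
Proof.
move=> g x [h /= h1 hx]; have [_ actM] := gactP U.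
exists (g * h * g^-1)%g => /=; last first.
  by rewrite /fixed_points /= -actM mulgKV actM hx.
apply: contra h1 => /eqP E.
have -> : h = (g^-1 * (g * h * g^-1) * g)%g by rewrite !mulgA mulVg mul1g mulgKV.
by rewrite E mulg1 mulVg.
Qed.

Lemma invariant_setU (G : finGroupType) (U : gset G) (A B : set U) :
  G_invariant A -> G_invariant B -> G_invariant (A `|` B).
Proof. by move=> HA HB g x [/HA|/HB]; [left|right]. Qed.

Definition sub_act (G : finGroupType) (U : gset G) (A : set U)
    (HA : G_invariant A) (g : G) (u : A) : A :=
  exist _ (gact g (val u)) (mem_set (HA g _ (set_mem (valP u)))).

Lemma sub_actP (G : finGroupType) (U : gset G) (A : set U) (HA : G_invariant A) :
  is_left_action (sub_act HA).
Proof.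
have [act1 actM] := gactP U.
by split=> [u|g h u]; apply: val_inj => /=; rewrite ?act1 ?actM.
Qed.

Definition sub_gset (G : finGroupType) (U : gset G) (A : set U)
  (HA : G_invariant A) : gset G := GSet (sub_actP HA).

(* Only the elements [(g, s)] of G^n x| Sigma_n are needed, not the group law. *)
Definition wreath (n : nat) (G : finGroupType) : Type :=
  ({ffun 'I_n -> G} * 'S_n)%type.

(* The [s(i)]-th entry of [(g, s).x] is [g_i.x_i]. *)
Definition wreath_act (n : nat) (G : finGroupType) (U : gset G)
    (w : wreath n G) (x : 'I_n -> U) : 'I_n -> U :=
  fun i => let j := (w.2^-1)%g i in gact (w.1 j) (x j).

Section Arrangement.
Context (G : finGroupType) (X : gspace G) (T : set (gspace_gset X)) (n : nat).
Local Notation act := (@gact G (gspace_gset X)).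

Definition diag_subspace (i j : 'I_n) (g : G) : set ('I_n -> gspace_gset X) :=
  [set x | act g (x i) = x j].

Definition point_subspace (i : 'I_n) (t : gspace_gset X) :
    set ('I_n -> gspace_gset X) :=
  [set x | x i = t].

Definition arrangement : set (set ('I_n -> gspace_gset X)) :=
  [set H | (exists (i j : 'I_n) (g : G), (i < j)%N /\ H = diag_subspace i j g)
        \/ (exists (i : 'I_n) (t : gspace_gset X), T t /\ H = point_subspace i t)].

Definition is_layer (L : set ('I_n -> gspace_gset X)) : Prop :=
  exists2 F : set (set ('I_n -> gspace_gset X)), F `<=` arrangement &
  exists2 x, (\bigcap_(H in F) H) x &
    L = @power_component X n (\bigcap_(H in F) H) x.

Definition layer : Type := {L : set ('I_n -> gspace_gset X) | is_layer L}.

Definition layer_set (L : layer) : set ('I_n -> gspace_gset X) := proj1_sig L.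

Definition layer_le (L L' : layer) : Prop := layer_set L' `<=` layer_set L.

End Arrangement.

Section PartialPartitions.
Context (G : finGroupType) (n : nat).

(* A coloring of the block [B = block_of b] is a partial function [b] on [n]. *)
Definition coloring := {ffun 'I_n -> option G}.

Definition block_of (b : coloring) : {set 'I_n} := [set i | isSome (b i)].

Definition color_mulr (b : coloring) (g : G) : coloring :=
  [ffun i => omap (fun a => (a * g)%g) (b i)].

(* The class of [b] under [b ~ bg], i.e. a projectivized coloring of [block_of b]. *)
Definition proj_color (b : coloring) : {set coloring} :=
  [set color_mulr b g | g : G].

Definition class_block (C : {set coloring}) : {set 'I_n} :=
  (\bigcup_(b in C) block_of b)%SET.

Definition is_partial_partition (beta : {set {set coloring}}) : bool :=
  [forall C in beta,
     [exists b, (block_of b != finset.set0) && (C == proj_color b)]] &&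
  [forall C in beta, forall C' in beta,
     (C != C') ==> [disjoint class_block C & class_block C']].

Definition zero_block (beta : {set {set coloring}}) : {set 'I_n} :=
  (~: \bigcup_(C in beta) class_block C)%SET.

Definition color_union (a b : coloring) : coloring :=
  [ffun i => if a i is Some h then Some h else b i].

Definition wreath_color (w : wreath n G) (b : coloring) : coloring :=
  [ffun i => let j := (w.2^-1)%g i in omap (fun a => (w.1 j * a)%g) (b j)].

Definition wreath_blocks (w : wreath n G) (beta : {set {set coloring}}) :
    {set {set coloring}} :=
  ((fun C : {set coloring} => wreath_color w @: C) @: beta)%SET.

End PartialPartitions.

Arguments proj_color {G n} b.
Arguments block_of {G n} b.

(* The zero coloring is a partial function defined exactly on the zero block. *)
Record dowling (G : finGroupType) (U : gset G) (n : nat) := Dowling {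
  blocks : {set {set coloring G n}};
  zero_color : {ffun 'I_n -> option U};
  dowlingP : is_partial_partition blocks &&
    [forall i, (i \in zero_block blocks) == isSome (zero_color i)]
}.

Section Dowling.
Context (G : finGroupType) (U : gset G) (n : nat).
Implicit Types d : dowling U n.

Definition merge_step d d' : Prop :=
  exists (a b : coloring G n) (g : G),
    [/\ proj_color a \in blocks d, proj_color b \in blocks d,
        proj_color a != proj_color b,
        blocks d' = (proj_color (color_union a (color_mulr b g)) |:
                       (blocks d :\: [set proj_color a; proj_color b]))%SET &
        zero_color d' = zero_color d].

Definition color_step d d' : Prop :=
  exists (b : coloring G n) (f : G -> U),
    [/\ proj_color b \in blocks d, equivariant f,
        blocks d' = (blocks d :\ proj_color b)%SET &
        forall i, zero_color d' i =
                  if b i is Some h then Some (f h) else zero_color d i].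

Definition dowling_le : dowling U n -> dowling U n -> Prop :=
  clos_refl_trans (dowling U n) (fun d d' => merge_step d d' \/ color_step d d').

Lemma block_of_mulr (b : coloring G n) g : block_of (color_mulr b g) = block_of b.
Proof. by apply/setP => i; rewrite !inE ffunE; case: (b i). Qed.

Lemma class_block_proj (b : coloring G n) :
  class_block (proj_color b) = block_of b.
Proof.
apply/setP => i; apply/bigcupP/idP => [[c /imsetP[g _ ->]]|ib].
  by rewrite block_of_mulr.
by exists (color_mulr b 1%g); [apply: imset_f | rewrite block_of_mulr].
Qed.

Lemma block_of_wreath (w : wreath n G) (b : coloring G n) i :
  (i \in block_of (wreath_color w b)) = ((w.2^-1)%g i \in block_of b).
Proof. by rewrite !inE ffunE /=; case: (b _). Qed.

Lemma class_block_wreath (w : wreath n G) (C : {set coloring G n}) i :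
  (i \in class_block (wreath_color w @: C)%SET) =
  ((w.2^-1)%g i \in class_block C).
Proof.
apply/bigcupP/bigcupP => [[c /imsetP[b bC ->]]|[b bC]] H.
  by exists b => //; rewrite -block_of_wreath.
by exists (wreath_color w b); [exact: imset_f | rewrite block_of_wreath].
Qed.

Lemma wreath_color_proj (w : wreath n G) (b : coloring G n) :
  (wreath_color w @: proj_color b)%SET = proj_color (wreath_color w b).
Proof.
rewrite /proj_color -imset_comp; apply: eq_imset => g /=.
by apply/ffunP => i; rewrite !ffunE /= !ffunE; case: (b _) => //= a; rewrite mulgA.
Qed.

Lemma wreath_partition (w : wreath n G) (beta : {set {set coloring G n}}) :
  is_partial_partition beta -> is_partial_partition (wreath_blocks w beta).
Proof.
case/andP => /forall_inP Hp /forall_inP Hd; apply/andP; split.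
  apply/forall_inP => _ /imsetP[C CB ->].
  have /existsP[b /andP[b0 /eqP ->]] := Hp _ CB.
  apply/existsP; exists (wreath_color w b).
  rewrite wreath_color_proj eqxx andbT.
  have /set0Pn[i ib] := b0; apply/set0Pn; exists (w.2 i).
  by rewrite block_of_wreath permK.
apply/forall_inP => _ /imsetP[C CB ->]; apply/forall_inP => _ /imsetP[D DB ->].
apply/implyP => CD.
have CD' : C != D by apply: contraNneq CD => ->.
have /forall_inP/(_ _ DB)/implyP/(_ CD') dis := Hd _ CB.
rewrite disjoint_subset; apply/fintype.subsetP => i; rewrite inE !class_block_wreath => iC.
by rewrite (disjointFr dis iC).
Qed.

Lemma zero_block_wreath (w : wreath n G) (beta : {set {set coloring G n}}) i :
  (i \in zero_block (wreath_blocks w beta)) = ((w.2^-1)%g i \in zero_block beta).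
Proof.
rewrite !finset.in_setC; congr (~~ _).
apply/bigcupP/bigcupP => [[_ /imsetP[C CB ->]]|[C CB]] H.
  by exists C => //; rewrite -class_block_wreath.
by exists (wreath_color w @: C)%SET; [exact: imset_f | rewrite class_block_wreath].
Qed.

Definition wreath_zero (w : wreath n G) (z : {ffun 'I_n -> option U}) :
    {ffun 'I_n -> option U} :=
  [ffun i => let j := (w.2^-1)%g i in omap (gact (w.1 j)) (z j)].

Lemma wreath_dowlingP (w : wreath n G) d :
  is_partial_partition (wreath_blocks w (blocks d)) &&
  [forall i, (i \in zero_block (wreath_blocks w (blocks d))) ==
             isSome (wreath_zero w (zero_color d) i)].
Proof.
have /andP[Hp /forallP Hz] := dowlingP d; rewrite wreath_partition //=.
apply/forallP => i; rewrite zero_block_wreath (eqP (Hz _)) ffunE /=.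
by case: (zero_color d _).
Qed.

Definition wreath_dowling (w : wreath n G) d : dowling U n :=
  Dowling (wreath_dowlingP w d).

End Dowling.

Definition poset_embedding (P Q : Type) (leP : P -> P -> Prop)
    (leQ : Q -> Q -> Prop) (f : P -> Q) : Prop :=
  injective f /\ forall x y, leP x y <-> leQ (f x) (f y).

Section Embedding.
Context (G : finGroupType) (X : gspace G) (T : set (gspace_gset X)) (n : nat).
Context (A : set (gspace_gset X)) (HA : G_invariant A).

(* In particular [w.L] is again a layer. *)
Definition wreath_equivariant (phi : layer T n -> dowling (sub_gset HA) n) : Prop :=
  forall (w : wreath n G) (L : layer T n), exists2 L' : layer T n,
    layer_set L' = wreath_act w @` layer_set L &
    phi L' = wreath_dowling w (phi L).

(* The points [x] with [x_i = z(i)] on the zero block and, for each block [B]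
   with coloring [b], [x_i = b(i).y] on [B] for a common point [y]. *)
Definition stratum (d : dowling (sub_gset HA) n) : set ('I_n -> gspace_gset X) :=
  [set x : 'I_n -> gspace_gset X | (forall (i : 'I_n) u, zero_color d i = Some u -> x i = val (u : A)) /\
     forall b, proj_color b \in blocks d -> exists y : gspace_gset X,
       forall (i : 'I_n) g, b i = Some g -> x i = gact g y].

(* Naturality of the embedding: a layer is sent to the combinatorial datum
   describing the coordinates of its points. *)
Definition natural_map (phi : layer T n -> dowling (sub_gset HA) n) : Prop :=
  forall L : layer T n, layer_set L = stratum (phi L).

(* z^{-1}(o) *)
Definition zero_fiber (d : dowling (sub_gset HA) n) (o : set (gspace_gset X)) :
    {set 'I_n} :=
  [set i | `[< exists2 u : A, zero_color d i = Some u & o (val u) >]].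

End Embedding.

(* Main.v *)
(* The set of points of [X^n] described by a datum [d] of the Dowling poset, its
   stratum, is connected: any two of its points are joined by moving one block
   at a time, each move being the image of [X] under a continuous map.  Points
   are closed, so a coordinate that is confined to the finite set [T `|` S] is
   constant on a component.  Hence every layer is a stratum.

   As [X] is connected, has two points and is T1, it is infinite, so every
   stratum has a generic point: outside the zero block its coordinates avoid
   [T `|` S], and different blocks lie in different orbits.  If [x] is generic
   for [d'] and lies in the stratum of [d], then merging the blocks of [d] on
   which [x] meets the same orbit and coloring those on which [x] meets
   [T `|` S] leads from [d] to [d'].  Thus strata are ordered by inclusion as
   their data are.

   A stratum is a component of the intersection of all the subspaces of the
   arrangement that contain it, provided that these confine each of its zero
   coordinates [s] to a finite set.  If [s] is not in [T], this takes a second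
   index in the orbit of [s]: two group elements then relate the two
   coordinates, as [s] has a nontrivial stabilizer.  Without such an index no
   subspace involves the coordinate, which is therefore free. *)
Require Import Defs.
From HB Require Import structures.
From mathcomp Require Import all_boot all_order all_fingroup all_algebra.
From mathcomp Require Import all_classical all_reals all_analysis.
From mathcomp Require Import finmap.
From mathcomp Require mpoly.
From Stdlib Require Import Relation_Operators.
Import -(notations) mpoly.
(* [Defs] comes last because MathComp has its own [gact] and [space]. *)
Import GRing.Theory Defs.

Set Implicit Arguments.
Unset Strict Implicit.
Unset Printing Implicit Defensive.

Local Open Scope classical_set_scope.

(** * Components in powers of a space *)

(** Holds by computation for every topology built from a subbase, so one continuity criterion serves
    the product topology and both Zariski topologies. *)
Definition has_subbase (Y : topologicalType) (D : set (set Y)) : Prop :=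
  forall A, open A <->
    exists2 B, B `<=` finI_from D id & \bigcup_(C in B) C = A.

Lemma zariski_subbase (k : closedFieldType) (V : variety k) :
  @has_subbase (zariski V) (@principal_open k V).
Proof. by move=> A; split. Qed.

Lemma zariski_power_subbase (k : closedFieldType) (V : variety k) n :
  @has_subbase (zariski_power V n) (@power_principal_open k V n).
Proof. by move=> A; split. Qed.

Lemma subbase_open (Y : topologicalType) (D : set (set Y)) (A : set Y) :
  has_subbase D -> D A -> open A.
Proof.
move=> sb DA; apply/sb; exists [set A]; last by rewrite bigcup_set1.
by move=> _ ->; exact: (@finI_from1 (set Y) Y D id).
Qed.

Lemma subbase_continuous (Z Y : topologicalType) (D : set (set Y)) (f : Z -> Y) :
  has_subbase D -> (forall A, D A -> open (f @^-1` A)) -> continuous f.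
Proof.
move=> sb fD; apply/continuousP => _ /sb [B BD <-].
rewrite preimage_bigcup; apply: bigcup_open => A /BD [E ED <-].
rewrite openE => z zE; rewrite /interior.
have -> : f @^-1` (\bigcap_(C in [set` E]) C) = \bigcap_(C in [set` E]) f @^-1` C.
  by rewrite preimage_bigcap.
apply: filter_bigI => C CE; apply: open_nbhs_nbhs; split; last exact: zE.
by apply: fD; exact/set_mem/ED.
Qed.

(** The rest of [C] lies in finitely many other closed fibres, so the fibre through [y] is both open
    and closed in [C]. *)
Lemma clopen_fibre (Y : topologicalType) (P : choiceType) (f : Y -> P) (K : set P) (C : set Y) :
  finite_set K -> (forall p, closed (f @^-1` [set p])) -> connected C ->
  (forall y, C y -> K (f y)) -> forall y y', C y -> C y' -> f y' = f y.
Proof.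
move=> Kf fc Cc CK y y' Cy Cy'.
suff E : C `&` f @^-1` [set f y] = C by move: Cy'; rewrite -E => -[].
apply: Cc; first by exists y.
- exists (~` (\bigcup_(p in K `\` [set f y]) f @^-1` [set p])).
    by rewrite openC; apply: closed_bigcup => //; exact: finite_setD.
  apply/seteqP; split=> [z [Cz fz]|z [Cz fz]]; split=> //.
    by move=> [p [_ /= np]] /= fzp; apply: np; rewrite -fzp fz.
  by apply: contrapT => nz; apply: fz; exists (f z) => //; split=> //; exact: CK.
- by exists (f @^-1` [set f y]).
Qed.


Lemma connected_T1_infinite (Y : topologicalType) :
  connected [set: Y] -> (forall p : Y, closed [set p]) ->
  (exists x y : Y, x <> y) -> infinite_set [set: Y].
Proof.
move=> Yc Y1 [x [y xy]] Yf; apply: xy.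
exact: (@clopen_fibre Y Y id setT setT Yf Y1 Yc (fun _ _ => I) y x I I).
Qed.

Lemma ptws_continuous (Z Y : topologicalType) (n : nat) (f : Z -> {ptws 'I_n -> Y}) :
  (forall i, continuous (fun z => f z i)) -> continuous f.
Proof.
move=> fi; apply: (@subbase_continuous Z {ptws 'I_n -> Y} (sup_subbase
  (fun i => Topological.class (initial_topology (fun g : 'I_n -> Y => g i))))).
  by move=> A; split.
move=> _ [i _ [B Bo <-]]; have /continuousP := fi i; exact.
Qed.

Lemma ptws_closed_coord (Y : topologicalType) (n : nat) (i : 'I_n) (t : Y) :
  hausdorff_space Y -> closed [set x : {ptws 'I_n -> Y} | x i = t].
Proof.
move=> hY; have pc : continuous (fun x : {ptws 'I_n -> Y} => x i).
  exact: (@proj_continuous _ (fun _ : 'I_n => Y) i).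
have /(_ [set t]) := (continuous_closedP _).1 pc; apply.
by apply: accessible_closed_set1; exact: hausdorff_accessible.
Qed.

(** * Zariski topologies on a variety and on its powers *)

Section Zariski.
Context (k : closedFieldType) (V : variety k).
Local Open Scope ring_scope.

Lemma zariski_nbhs (j : var_index V) (q : mpoly (var_ambient V) k) (y : zariski V) :
  chart_dom j y -> peval q (chart j y) != 0 ->
  nbhs y [set z : zariski V | chart_dom j z /\ peval q (chart j z) != 0].
Proof.
move=> yj qy; apply: open_nbhs_nbhs; split => //.
by apply: subbase_open (@zariski_subbase k V) _; exists j, q.
Qed.

(** Take a chart around [y]. If [t] is outside it, the whole chart ([q = 1]) is a neighbourhood of
    [y] missing [t]; otherwise some coordinate separates [y] from [t]. *)
Lemma zariski_closed1 (t : zariski V) : closed [set t].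
Proof.
rewrite -openC openE => y /= yt; have [j yj] := chart_cover (y : var_point V).
have [tj|tj] := pselect (chart_dom j t); last first.
  have := @zariski_nbhs j 1 y yj; rewrite /peval meval1 oner_neq0 => /(_ isT).
  by apply: filterS => z [zj _] zt; apply: tj; rewrite -zt.
have /eqP : chart j y <> chart j t by move=> e; apply: yt; exact: chart_inj e.
rewrite -subr_eq0 => /rV0Pn[l]; rewrite !mxE => yl.
pose q : mpoly (var_ambient V) k := mpolyX k (mnm1 l) - mpolyC _ (chart j t ord0 l).
have qE z : peval q (chart j z) = chart j z ord0 l - chart j t ord0 l.
  by rewrite /peval mevalB mevalXU mevalC.
have := @zariski_nbhs j q y yj; rewrite qE => /(_ yl).
by apply: filterS => z [_]; rewrite qE => + zt; rewrite zt subrr eqxx.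
Qed.

Lemma zariski_power_nbhs n (a : 'I_n -> var_index V) (q : mpoly (n * var_ambient V) k)
    (x : zariski_power V n) :
  (forall i, chart_dom (a i) (x i)) -> peval q (power_chart a x) != 0 ->
  nbhs x [set z : zariski_power V n |
    (forall i, chart_dom (a i) (z i)) /\ peval q (power_chart a z) != 0].
Proof.
move=> xa qx; apply: open_nbhs_nbhs; split => //.
by apply: subbase_open (@zariski_power_subbase k V n) _; exists a, q.
Qed.

Lemma zariski_closed_coord n (i : 'I_n) (t : var_point V) :
  closed [set x : zariski_power V n | x i = t].
Proof.
rewrite -openC openE => x /= xt.
have [a xa] := choice (fun j => chart_cover (x j)).
have [tj|tj] := pselect (chart_dom (a i) t); last first.
  have := @zariski_power_nbhs n a 1 x xa; rewrite /peval meval1 oner_neq0 => /(_ isT).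
  by apply: filterS => z [za _] zt; apply: tj; rewrite -zt; exact: za.
have /eqP : chart (a i) (x i) <> chart (a i) t.
  by move=> e; apply: xt; exact: chart_inj e.
rewrite -subr_eq0 => /rV0Pn[l]; rewrite !mxE => xl.
pose q : mpoly (n * var_ambient V) k :=
  mpolyX k (mnm1 (mxvec_index i l)) - mpolyC _ (chart (a i) t ord0 l).
have qE z : peval q (power_chart a z) = chart (a i) (z i) ord0 l - chart (a i) t ord0 l.
  by rewrite /peval mevalB mevalXU mevalC /power_chart mxvecE mxE.
have := @zariski_power_nbhs n a q x xa; rewrite qE => /(_ xl).
by apply: filterS => z [_]; rewrite qE => + zt; rewrite zt subrr eqxx.
Qed.

(** Functions regular at a point form a ring containing the constants. A polynomial in the chart
    coordinates of a map is therefore regular, which controls preimages of principal open sets. *)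
Definition regular_at (j : var_index V) (y : var_point V) (f : var_point V -> k) :=
  exists p q : mpoly (var_ambient V) k, peval q (chart j y) != 0 /\
    forall z, chart_dom j z -> peval q (chart j z) != 0 ->
      f z = peval p (chart j z) / peval q (chart j z).

Lemma regular_at_cst j y c : regular_at j y (fun=> c).
Proof.
exists (mpolyC _ c), 1; rewrite /peval meval1 oner_neq0; split=> // z _ _.
by rewrite mevalC meval1 divr1.
Qed.

Lemma regular_atD j y f g :
  regular_at j y f -> regular_at j y g -> regular_at j y (fun z => f z + g z).
Proof.
move=> [p [q [qy fE]]] [p' [q' [q'y gE]]].
exists (p * q' + p' * q), (q * q'); rewrite /peval mevalM mulf_neq0 //.
split=> // z zj; rewrite mevalM mulf_eq0 negb_or => /andP[qz q'z].
by rewrite fE // gE // /peval mevalD !mevalM addf_div.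
Qed.

Lemma regular_atM j y f g :
  regular_at j y f -> regular_at j y g -> regular_at j y (fun z => f z * g z).
Proof.
move=> [p [q [qy fE]]] [p' [q' [q'y gE]]].
exists (p * p'), (q * q'); rewrite /peval mevalM mulf_neq0 //.
split=> // z zj; rewrite mevalM mulf_eq0 negb_or => /andP[qz q'z].
by rewrite fE // gE // /peval !mevalM mulf_div.
Qed.

(** Three nested inductions: on the monomials of [p], on the variables of a monomial, and on the
    exponent of a variable. *)
Lemma regular_at_meval j y N (p : mpoly N k) (f : 'I_N -> var_point V -> k) :
  (forall l, regular_at j y (f l)) -> regular_at j y (fun z => meval (f^~ z) p).
Proof.
move=> fr; under eq_fun do rewrite mevalE.
elim: (msupp p) => [|m s IHs].
  by under eq_fun do rewrite big_nil; exact: regular_at_cst.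
under eq_fun do rewrite big_cons; apply: regular_atD => //.
apply: regular_atM; first exact: regular_at_cst.
elim: (index_enum _) => [|l r IHr].
  by under eq_fun do rewrite big_nil; exact: regular_at_cst.
under eq_fun do rewrite big_cons; apply: regular_atM => //.
elim: (m l) => [|e IHe]; first exact: regular_at_cst.
by under eq_fun do rewrite exprS; exact: regular_atM.
Qed.

(** If [f = p / q] near [y], the principal open set of [p * q] is a neighbourhood of [y] on which
    [f] does not vanish. *)
Lemma regular_at_nbhs j (y : zariski V) f : chart_dom j y -> regular_at j y f ->
  f y != 0 -> nbhs y [set z : zariski V | f z != 0].
Proof.
move=> yj [p [q [qy fE]]]; rewrite fE // mulf_eq0 negb_or invr_eq0 => /andP[py _].
have := @zariski_nbhs j (p * q) y yj; rewrite /peval mevalM mulf_neq0 // => /(_ isT).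
apply: filterS => z [zj]; rewrite mevalM mulf_eq0 negb_or => /andP[pz qz] /=.
by rewrite fE // mulf_neq0 // invr_eq0.
Qed.

(* Continuity for the product topology would not suffice: the Zariski topology
   of [V^n] is finer. *)
Lemma zariski_power_continuous n (f : 'I_n -> var_point V -> var_point V) :
  (forall i, regular_map (f i) \/ exists c, f i = fun=> c) ->
  continuous ((fun z i => f i z) : zariski V -> zariski_power V n).
Proof.
move=> fr; apply: subbase_continuous (@zariski_power_subbase k V n) _.
move=> _ [a [p ->]]; rewrite openE => y [ya py].
have [j yj] := chart_cover (y : var_point V).
(* Regularity includes that, near [y], the values stay in the chosen chart. *)
have fdom i : nbhs y [set z : zariski V | chart_dom (a i) (f i z)].
  case: (fr i) => [fi|[c fc]]; last first.
    by apply: filterE => z /=; have := ya i; rewrite fc.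
  have [q [qy [P fE]]] := fi _ _ _ yj (ya i).
  have := @zariski_nbhs j q y yj qy; apply: filterS => z [zj qz].
  by have [] := fE z zj qz.
have coord i l : regular_at j y (fun z => chart (a i) (f i z) ord0 l).
  case: (fr i) => [fi|[c ->]]; last exact: regular_at_cst.
  have [q [qy [P fE]]] := fi _ _ _ yj (ya i).
  by exists (P l), q; split=> // z zj qz; have [_ ->] := fE z zj qz.
have preg : regular_at j y (fun z => peval p (power_chart a (fun i => f i z))).
  apply: (@regular_at_meval j y _ p
    (fun l z => power_chart a (fun i => f i z) ord0 l)) => l.
  case/mxvec_indexP: l => i l; under eq_fun do rewrite /power_chart mxvecE mxE.
  exact: coord.
have nb := @regular_at_nbhs _ (y : zariski V) _ yj preg py.
have nd := @filter_forall _ _ _ _ (nbhs_filter (y : zariski V)) fdom.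
by apply: filterS2 nb nd => z pz za; split.
Qed.

End Zariski.

(** * Components of subsets of the power, for both kinds of space *)

Section Power.
Context (X : space) (n : nat).
Local Notation power := ('I_n -> space_point X).
Implicit Types (A : set power) (x : power).

Lemma power_component_sub A x : power_component A x `<=` A.
Proof.
case: X A x => [R Y|k V] A x /=.
  exact: (@connected_component_sub {ptws 'I_n -> Y}).
exact: (@connected_component_sub (zariski_power V n)).
Qed.

Lemma power_component_refl A x : A x -> power_component A x x.
Proof.
case: X A x => [R Y|k V] A x /=.
  exact: (@connected_component_refl {ptws 'I_n -> Y}).
exact: (@connected_component_refl (zariski_power V n)).
Qed.

Lemma power_component_trans A x y z : power_component A x y ->
  power_component A y z -> power_component A x z.
Proof.
case: X A x y z => [R Y|k V] A x y z /=; exact: connected_component_trans.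
Qed.

(** The family [f^~ y] is a continuous image of the connected space, contained in [A]. *)
Lemma power_component_image A (f : 'I_n -> space_point X -> space_point X) y z :
  connected_space X ->
  (forall i, space_morphism (f i) \/ exists c, f i = fun=> c) ->
  (forall y, A (f^~ y)) -> power_component A (f^~ y) (f^~ z).
Proof.
case: X A f y z => [R Y|k V] A f y z /= Yc fc fA.
  apply: (@connected_component_max {ptws 'I_n -> Y} A (range (fun y i => f i y))).
  - by exists y.
  - by move=> _ [u _ <-].
  - apply: connected_continuous_connected Yc _; apply: continuous_subspaceT.
    apply: (@ptws_continuous Y Y n (fun y i => f i y)) => i.
    by case: (fc i) => // -[c ->]; exact: cst_continuous.
  - by exists z.
apply: (@connected_component_max (zariski_power V n) A (range (fun y i => f i y))).
- by exists y.
- by move=> _ [u _ <-].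
- apply: connected_continuous_connected Yc _; apply: continuous_subspaceT.
  exact: zariski_power_continuous.
- by exists z.
Qed.

Lemma power_component_discrete A (K : set (space_point X)) i x y :
  finite_set K -> (forall u, A u -> K (u i)) ->
  A x -> power_component A x y -> y i = x i.
Proof.
case: X A K x y => [R Y|k V] A K x y /= Kf AK Ax xy.
  apply: (@clopen_fibre {ptws 'I_n -> Y} Y (fun u => u i) K _ Kf _
    (@component_connected {ptws 'I_n -> Y} A x)) => //.
  - move=> p; apply: ptws_closed_coord; exact: cw_hausdorff.
  - by move=> u /connected_component_sub /AK.
  - exact: connected_component_refl.
apply: (@clopen_fibre (zariski_power V n) (var_point V) (fun u => u i) K _ Kf _
  (@component_connected (zariski_power V n) A x)) => //.
- by move=> p; exact: zariski_closed_coord.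
- by move=> u /connected_component_sub /AK.
- exact: connected_component_refl.
Qed.

End Power.

Lemma connected_space_infinite (X : space) : connected_space X ->
  (exists x y : space_point X, x <> y) -> infinite_set [set: space_point X].
Proof.
case: X => [R Y|k V] /= Yc XY.
  apply: connected_T1_infinite => // p; apply: accessible_closed_set1.
  by apply: hausdorff_accessible; exact: cw_hausdorff.
by apply: (@connected_T1_infinite (zariski V)) => //; exact: zariski_closed1.
Qed.

(** * Colorings and the Dowling poset *)

Lemma gactK (G : finGroupType) (U : gset G) (g : G) (x : U) :
  gact (g^-1)%g (gact g x) = x.
Proof. by have [a1 aM] := gactP U; rewrite -aM mulVg a1. Qed.

Lemma gactM (G : finGroupType) (U : gset G) (g h : G) (x : U) :
  gact (g * h)%g x = gact g (gact h x).
Proof. by have [_ ->] := gactP U. Qed.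

Lemma gact1 (G : finGroupType) (U : gset G) (x : U) : gact 1%g x = x.
Proof. by have [-> _] := gactP U. Qed.

Lemma G_invariantE (G : finGroupType) (U : gset G) (A : set U) g x :
  G_invariant A -> A (gact g x) <-> A x.
Proof. by move=> HA; split=> [/(HA (g^-1)%g)|/HA //]; rewrite gactK. Qed.

(** Otherwise [g^-1 * h] would be a nontrivial element fixing [x]. *)
Lemma Sing_free (G : finGroupType) (U : gset G) (x : U) (g h : G) :
  ~ @Sing G U x -> gact g x = gact h x -> g = h.
Proof.
move=> nx gh; apply/eqP; rewrite eq_mulVg1; apply: contrapT => /negP nk.
by apply: nx; exists (g^-1 * h)%g => //=; rewrite /fixed_points /= gactM -gh gactK.
Qed.

Section Colorings.
Context (G : finGroupType) (n : nat).
Implicit Types (a b c : coloring G n) (beta : {set {set coloring G n}}).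

Lemma color_mulr1 b : color_mulr b 1%g = b.
Proof. by apply/ffunP => i; rewrite ffunE; case: (b i) => //= h; rewrite mulg1. Qed.

Lemma color_mulrM b g h : color_mulr (color_mulr b g) h = color_mulr b (g * h)%g.
Proof. by apply/ffunP => i; rewrite !ffunE; case: (b i) => //= k; rewrite mulgA. Qed.

Lemma color_mulrP b g i h :
  color_mulr b g i = Some h <-> exists2 l, b i = Some l & h = (l * g)%g.
Proof.
rewrite ffunE; case: (b i) => [l|]; split=> //=; last by case.
  by case=> <-; exists l.
by case=> _ [<-] ->.
Qed.

Lemma proj_color_mulr b g : proj_color (color_mulr b g) = proj_color b.
Proof.
apply/setP => c; apply/imsetP/imsetP => -[h _ ->].
  by exists (g * h)%g => //; rewrite color_mulrM.
by exists (g^-1 * h)%g => //; rewrite color_mulrM mulKVg.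
Qed.

Lemma proj_color_eqP a b :
  proj_color a = proj_color b <-> exists g, b = color_mulr a g.
Proof.
split=> [e|[g ->]]; last by rewrite proj_color_mulr.
have : b \in proj_color a.
  by rewrite e; apply/imsetP; exists 1%g => //; rewrite color_mulr1.
by case/imsetP => g _ ->; exists g.
Qed.

Lemma block_ofP b i : reflect (exists h, b i = Some h) (i \in block_of b).
Proof. by rewrite inE; case: (b i) => [h|]; constructor; [exists h|case]. Qed.

Lemma proj_color_domain a b i h : proj_color a = proj_color b -> a i = Some h ->
  exists k, b i = Some k.
Proof. by case/proj_color_eqP => g -> ai; rewrite ffunE ai; exists (h * g)%g. Qed.

(** Disjointness is put in terms of representatives: colorings defined at a common index have the
    same class. Later arguments can then work with colorings only. *)
Lemma is_partial_partitionP beta :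
  reflect ((forall C, C \in beta -> exists b i h, C = proj_color b /\ b i = Some h) /\
           (forall b c i h k, proj_color b \in beta -> proj_color c \in beta ->
              b i = Some h -> c i = Some k -> proj_color b = proj_color c))
    (is_partial_partition beta).
Proof.
apply: (iffP andP) => -[H1 H2]; split.
- move=> C /(forall_inP H1)/existsP[b /andP[/set0Pn[i /block_ofP[h bi]] /eqP ->]].
  by exists b, i, h.
- move=> b c i h k bB cB bi ci; apply: contrapT => /eqP ne.
  have /forall_inP/(_ _ cB)/implyP/(_ ne) := forall_inP H2 _ bB.
  rewrite !class_block_proj => /disjointFr bc.
  by have := bc i; rewrite !inE bi ci => /(_ isT).
- apply/forall_inP => C /H1[b [i [h [-> bi]]]]; apply/existsP; exists b.
  by rewrite eqxx andbT; apply/set0Pn; exists i; apply/block_ofP; exists h.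
- apply/forall_inP => B bB; apply/forall_inP => C cB; apply/implyP.
  apply: contraNT; rewrite -setI_eq0 => /set0Pn[i]; rewrite finset.in_setI.
  have [b [_ [_ [Eb _]]]] := H1 _ bB; have [c [_ [_ [Ec _]]]] := H1 _ cB.
  rewrite Eb Ec !class_block_proj => /andP[/block_ofP[h bi] /block_ofP[k ci]].
  by apply/eqP; apply: (H2 _ _ i h k) => //; rewrite -?Eb -?Ec.
Qed.

Lemma zero_blockP beta i : is_partial_partition beta ->
  reflect (forall b, proj_color b \in beta -> b i = None) (i \in zero_block beta).
Proof.
case/is_partial_partitionP => H1 _; rewrite inE; apply: (iffP negP) => H.
  move=> b bB; case E : (b i) => [h|] //; case: H; apply/bigcupP.
  by exists (proj_color b) => //; rewrite class_block_proj; apply/block_ofP; exists h.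
case/bigcupP => C /[dup] CB /H1[b [_ [_ [EC _]]]].
by rewrite EC class_block_proj => /block_ofP[h]; rewrite H // -EC.
Qed.

Lemma color_unionP a b i h : color_union a b i = Some h ->
  a i = Some h \/ (a i = None /\ b i = Some h).
Proof. by rewrite ffunE; case: (a i) => [l|]; [left|right]. Qed.

(** Disjointness matters because [color_union] prefers [a] wherever both colorings are defined. *)
Lemma color_union_proj a b g i h :
  (forall i k, a i = Some k -> b i = None) -> b i = Some h ->
  color_union a (color_mulr b g) i = Some (h * g)%g.
Proof.
move=> ab bi; rewrite !ffunE bi; case E : (a i) => [k|] //.
by have := ab _ _ E; rewrite bi.
Qed.

End Colorings.

Section DowlingPoset.
Context (G : finGroupType) (U : gset G) (n : nat).
Implicit Types (d : dowling U n) (a b c : coloring G n).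

Lemma dowling_eq d d' : blocks d = blocks d' -> zero_color d = zero_color d' -> d = d'.
Proof.
case: d d' => [B z p] [B' z' p'] /= EB Ez; case: _ / EB p'; case: _ / Ez => p'.
by congr Dowling; exact: bool_irrelevance.
Qed.

Lemma blocks_partition d : is_partial_partition (blocks d).
Proof. by have /andP[] := dowlingP d. Qed.

Lemma dowling_block d C : C \in blocks d ->
  exists b i h, C = proj_color b /\ b i = Some h.
Proof. by have /is_partial_partitionP[H _] := blocks_partition d; exact: H. Qed.

Lemma dowling_block_eq d b c i h k : proj_color b \in blocks d ->
  proj_color c \in blocks d -> b i = Some h -> c i = Some k ->
  proj_color b = proj_color c.
Proof. by have /is_partial_partitionP[_] := blocks_partition d; apply. Qed.

Lemma zero_color_block d b i h : proj_color b \in blocks d -> b i = Some h ->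
  zero_color d i = None.
Proof.
move=> bB bi; have /andP[pp /forallP/(_ i)/eqP] := dowlingP d.
case: (zero_blockP i pp) => [/(_ _ bB)|_]; first by rewrite bi.
by case: (zero_color d i).
Qed.

Lemma zero_color_None d i : zero_color d i = None ->
  exists b h, proj_color b \in blocks d /\ b i = Some h.
Proof.
move=> zi; have /andP[pp /forallP/(_ i)/eqP] := dowlingP d.
rewrite zi; case: (zero_blockP i pp) => // H _; apply: contrapT => N; apply: H => b bB.
by case E : (b i) => [h|] //; case: N; exists b, h.
Qed.

(** The common way to construct a datum, used for merging, for coloring and for the datum of a
    layer. *)
Lemma dowling_build (beta : {set {set coloring G n}}) (z : {ffun 'I_n -> option U}) :
  (forall C, C \in beta -> exists b i h, C = proj_color b /\ b i = Some h) ->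
  (forall b c i h k, proj_color b \in beta -> proj_color c \in beta ->
    b i = Some h -> c i = Some k -> proj_color b = proj_color c) ->
  (forall b i h, proj_color b \in beta -> b i = Some h -> z i = None) ->
  (forall i, z i = None -> exists b h, proj_color b \in beta /\ b i = Some h) ->
  exists d, blocks d = beta /\ zero_color d = z.
Proof.
move=> H1 H2 H3 H4.
have pp : is_partial_partition beta by apply/is_partial_partitionP.
have P : is_partial_partition beta &&
    [forall i, (i \in zero_block beta) == isSome (z i)].
  rewrite pp /=; apply/forallP => i; apply/eqP; case: (zero_blockP i pp) => H.
    by case E : (z i) => //; have [b [h [bB bi]]] := H4 _ E; rewrite H in bi.
  case E : (z i) => [u|] //; case: H => b bB; case Eb : (b i) => [h|] //.
  by have := H3 _ _ _ bB Eb; rewrite E.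
by exists (Dowling P).
Qed.

Lemma dowling_merge d a b g : proj_color a \in blocks d -> proj_color b \in blocks d ->
  proj_color a != proj_color b -> exists d',
  blocks d' = (proj_color (color_union a (color_mulr b g)) |:
                (blocks d :\: [set proj_color a; proj_color b]))%SET /\
  zero_color d' = zero_color d.
Proof.
move=> aB bB ab; set c := color_union _ _.
have cE e i h : proj_color e = proj_color c -> e i = Some h ->
    (exists k, a i = Some k) \/ (exists k, b i = Some k).
  move=> /proj_color_domain/[apply] -[k]; rewrite !ffunE.
  by case: (a i) => [l|]; [left; exists l|case: (b i) => // l; right; exists l].
(* An old block that meets the new one is one of the two merged blocks, and these have been
   removed. *)
have cN e f i h k : proj_color e = proj_color c -> proj_color f \in blocks d ->
    e i = Some h -> f i = Some k ->
    proj_color f = proj_color a \/ proj_color f = proj_color b.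
  move=> ec fB ei fi; case: (cE _ _ _ ec ei) => -[l li]; [left|right].
    exact: dowling_block_eq fB aB fi li.
  exact: dowling_block_eq fB bB fi li.
apply: dowling_build.
- move=> C /setU1P[->|/setDP[CB _]]; last exact: dowling_block CB.
  have [e [i [h [ea ei]]]] := dowling_block aB.
  have [k ai] := proj_color_domain (esym ea) ei.
  by exists c, i, k; split=> //; rewrite ffunE ai.
- move=> e f i h k /setU1P[ec|/setDP[eB ne]] /setU1P[fc|/setDP[fB nf]] ei fi.
  + by rewrite ec fc.
  + by case: (cN _ _ _ _ _ ec fB ei fi) nf => ->; rewrite !inE eqxx ?orbT.
  + by case: (cN _ _ _ _ _ fc eB fi ei) ne => ->; rewrite !inE eqxx ?orbT.
  + exact: dowling_block_eq eB fB ei fi.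
- move=> e i h /setU1P[ec|/setDP[eB _]] ei; last exact: zero_color_block eB ei.
  by case: (cE _ _ _ ec ei) => -[k]; exact: zero_color_block.
- move=> i /zero_color_None[e [h [eB ei]]].
  have [ab'|nab] := boolP (proj_color e \in [set proj_color a; proj_color b]%SET).
    have [k ci] : exists k, c i = Some k.
      rewrite !ffunE; case/set2P: ab' => /proj_color_domain/(_ ei)[k ->].
        by exists k.
      by case: (a i) => [l|]; [exists l|exists (k * g)%g].
    by exists c, k; rewrite setU11.
  by exists e, h; rewrite !inE in nab *; rewrite nab eB orbT.
Qed.

Lemma dowling_color d b (f : G -> U) : proj_color b \in blocks d -> exists d',
  blocks d' = (blocks d :\ proj_color b)%SET /\
  forall i, zero_color d' i = if b i is Some h then Some (f h) else zero_color d i.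
Proof.
move=> bB.
pose z := [ffun i => if b i is Some h then Some (f h) else zero_color d i].
have [|||i|d' [Ed Ez]] := @dowling_build (blocks d :\ proj_color b)%SET z.
- by move=> C /setD1P[_ /dowling_block].
- by move=> e c i h k /setD1P[_ eB] /setD1P[_ cB] ei ci; exact: dowling_block_eq eB cB ei ci.
- move=> e i h /setD1P[ne eB] ei; rewrite ffunE.
  case bi : (b i) => [k|]; last exact: zero_color_block eB ei.
  by rewrite (dowling_block_eq eB bB ei bi) eqxx in ne.
- rewrite ffunE; case bi : (b i) => [//|] /zero_color_None[e [h [eB ei]]].
  exists e, h; split=> //; rewrite !inE eB andbT; apply/eqP => eb.
  by have [k] := proj_color_domain eb ei; rewrite bi.
- by exists d'; split=> // i; rewrite Ez ffunE.
Qed.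

(** A merge replaces two blocks by one and a coloring drops one. The strict decrease yields
    antisymmetry and the induction in [generic_le]. *)
Lemma card_step d d' : merge_step d d' \/ color_step d d' ->
  (#|blocks d'| < #|blocks d|)%N.
Proof.
case=> [[a [b [g [aB bB ab -> _]]]]|[b [f [bB _ -> _]]]]; last first.
  by rewrite [X in (_ < X)%N](cardsD1 (proj_color b)) bB.
have sub : [set proj_color a; proj_color b]%SET \subset blocks d.
  by apply/fintype.subsetP => C /set2P[] ->.
rewrite (leq_ltn_trans (leq_card_setU _ _)) // cards1 cardsD (finset.setIidPr sub) cards2 ab.
have := subset_leq_card sub; rewrite cards2 ab /=.
by case: #|blocks d| => [|[|m]] // _; rewrite !subSS subn0 add1n.
Qed.

Lemma dowling_le_card d d' : dowling_le d d' ->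
  d = d' \/ (#|blocks d'| < #|blocks d|)%N.
Proof.
elim=> {d d'} [d d' /card_step|d|d d1 d2 _ [->|H1] _ [<-|H2]]; try by [left|right].
by right; exact: ltn_trans H2 H1.
Qed.

Lemma dowling_le_anti d d' : dowling_le d d' -> dowling_le d' d -> d = d'.
Proof.
move=> /dowling_le_card[//|H] /dowling_le_card[//|/(ltn_trans H)].
by rewrite ltnn.
Qed.

End DowlingPoset.

(** * Strata and their generic points *)

Section Strata.
Context (G : finGroupType) (X : gspace G) (n : nat).
Context (A : set (gspace_gset X)) (HA : G_invariant A).
Hypothesis Sing_A : @Sing G (gspace_gset X) `<=` A.
Implicit Types (d : dowling (sub_gset HA) n) (a b c : coloring G n).
Implicit Types (x y : 'I_n -> gspace_gset X).

Lemma free_outside (p : gspace_gset X) (g h : G) :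
  ~ A p -> gact g p = gact h p -> g = h.
Proof. by move=> pA; apply: Sing_free => /Sing_A. Qed.

Lemma stratum_zero d x i u : stratum d x -> zero_color d i = Some u -> x i = val u.
Proof. by case=> + _; apply. Qed.

Lemma stratum_block d x b i j h k : stratum d x -> proj_color b \in blocks d ->
  b i = Some h -> b j = Some k -> x j = gact (k * h^-1)%g (x i).
Proof.
by case=> _ H /H[p pE] bi bj; rewrite (pE _ _ bi) (pE _ _ bj) -gactM mulgKV.
Qed.

(** If [p] is the common point of a merged block, then [p] serves for [a] and [g.p] for [b]. A block
    colored through [f] has common point [f 1], by equivariance. Another representative [b k] of a
    class moves the common point by [k^-1]. *)
Lemma stratum_step d d' : merge_step d d' \/ color_step d d' ->
  stratum d' `<=` stratum d.
Proof.
case=> [[a [b [g [aB bB ab EB Ez]]]]|[b [f [bB fe EB Ez]]]] x [xz xb].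
  have dis i k : a i = Some k -> b i = None.
    move=> ai; case E : (b i) => [h|] //; have := dowling_block_eq aB bB ai E.
    by move/eqP; rewrite (negbTE ab).
  have [|p pE] := xb (color_union a (color_mulr b g)); first by rewrite EB setU11.
  split=> [i u|c cB]; first by rewrite -Ez; exact: xz.
  have [/eqP|ca] := boolP (proj_color c == proj_color a).
    move/esym/proj_color_eqP => [k ->]; exists (gact (k^-1)%g p) => i h.
    case/color_mulrP=> l E ->.
    by rewrite -gactM mulgK; apply: pE; rewrite ffunE E.
  have [/eqP|cb] := boolP (proj_color c == proj_color b).
    move/esym/proj_color_eqP => [k ->]; exists (gact (k^-1 * g)%g p) => i h.
    case/color_mulrP=> l E ->.
    rewrite -gactM mulgA mulgK; apply: pE; exact: color_union_proj dis E.
  by apply: xb; rewrite EB !inE (negbTE ca) (negbTE cb) cB orbT.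
split=> [i u zi|c cB].
  apply: xz; rewrite Ez; case bi : (b i) => [h|] //.
  by rewrite (zero_color_block bB bi) in zi.
have [/eqP|cb] := boolP (proj_color c == proj_color b); last first.
  by apply: xb; rewrite EB !inE cb cB.
move/esym/proj_color_eqP => [k ->]; exists (gact (k^-1)%g (val (f 1%g))) => i h.
case/color_mulrP=> l E ->.
rewrite -gactM mulgK (xz i (f l)); first by rewrite -{1}[l]mulg1 fe.
by rewrite Ez E.
Qed.

Lemma stratum_le d d' : dowling_le d d' -> stratum d' `<=` stratum d.
Proof.
elim=> {d d'} [d d' /stratum_step//|d //|d d1 d2 _ H1 _ H2].
exact: subset_trans H2 H1.
Qed.

(** The last clause says that coordinates in one orbit lie in one block. A generic point determines
    its datum, see [generic_eq]. *)
Definition generic d x : Prop :=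
  [/\ stratum d x,
      forall i, zero_color d i = None -> ~ A (x i) &
      forall b i j g h, proj_color b \in blocks d -> b i = Some h ->
        gact g (x i) = x j -> b j <> None].

Lemma generic_zero d x i : generic d x -> A (x i) ->
  exists2 u, zero_color d i = Some u & x i = val u.
Proof.
move=> [sx xz _] xA; case E : (zero_color d i) => [u|]; last by case: (xz _ E).
by exists u => //; exact: stratum_zero sx E.
Qed.

(** An index [i] of a block of [d] has [x i] outside [A], so it also lies in a block of [d']. Both
    blocks consist of the indices whose coordinate is in the orbit of [x i], and their colors agree
    up to a right factor as [x i] has trivial stabilizer. *)
Lemma generic_sub d d' x : generic d x -> generic d' x -> blocks d \subset blocks d'.
Proof.
move=> gd gd'; have [sx xz xb] := gd; have [sx' xz' xb'] := gd'.
apply/fintype.subsetP => C /[dup] CB /dowling_block[b [i [h [EC bi]]]].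
have {}CB : proj_color b \in blocks d by rewrite -EC.
have nA := xz _ (zero_color_block CB bi).
have /zero_color_None[c [k [cB ci]]] : zero_color d' i = None.
  by case E : (zero_color d' i) => [u|] //; case: nA; rewrite (stratum_zero sx' E); exact: set_valP.
suff -> : C = proj_color c by [].
(* The right factor is forced at [i], where [h] must become [k]. *)
rewrite EC; apply/proj_color_eqP; exists (h^-1 * k)%g; apply/ffunP => j.
rewrite ffunE; case bj : (b j) => [l|] /=.
  have xj := stratum_block sx CB bi bj.
  case cj : (c j) (xb' c i j _ k cB ci (esym xj)) => [m|] // _.
  have := stratum_block sx' cB ci cj; rewrite xj => /(free_outside nA)/(canRL (mulgK _)).
  by rewrite invgK => ->; rewrite !mulgA mulgK mulgKV.
case cj : (c j) => [m|] //.
by case: (xb b i j _ h CB bi (esym (stratum_block sx' cB ci cj))).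
Qed.

Lemma generic_eq d d' x : generic d x -> generic d' x -> d = d'.
Proof.
move=> gd gd'; apply: dowling_eq.
  by apply/eqP; rewrite finset.eqEsubset (generic_sub gd gd') (generic_sub gd' gd).
have [sx _ _] := gd; have [sx' _ _] := gd'.
apply/ffunP => i; case E : (zero_color d i) => [u|].
  have xi := stratum_zero sx E; have [|v -> xi'] := generic_zero gd' (i := i).
    by rewrite xi; exact: set_valP.
  by congr Some; apply: val_inj; rewrite -xi -xi'.
case E' : (zero_color d' i) => [v|] //; have xi := stratum_zero sx' E'.
have [|u] := generic_zero gd (i := i); first by rewrite xi; exact: set_valP.
by rewrite E.
Qed.

(** Induction on the number of blocks of [d]: a coloring or a merge is applied while keeping [x] in
    the stratum. When neither is possible, [x] is generic for [d], and [generic_eq] gives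
    [d = d']. *)
Lemma generic_le d d' x : generic d' x -> stratum d x -> dowling_le d d'.
Proof.
move=> gd'; have [m] := ubnP #|blocks d|; elim: m d => // m IHm d dm sx.
have step d1 : merge_step d d1 \/ color_step d d1 -> stratum d1 x ->
    dowling_le d d1 /\ dowling_le d1 d'.
  move=> s1 sx1; split; first exact: rt_step.
  by apply: IHm => //; have := card_step s1; move: dm; rewrite ltnS => /[swap] /leq_trans/[apply].
suff [gd|[d1 [s1 sx1]]] : generic d x \/
    exists d1, (merge_step d d1 \/ color_step d d1) /\ stratum d1 x.
- by rewrite (generic_eq gd gd'); exact: rt_refl.
- by have [H1 H2] := step _ s1 sx1; exact: rt_trans H1 H2.
have [[b [i [h [bB bi xA]]]]|Nz] := pselect (exists b i h,
    [/\ proj_color b \in blocks d, b i = Some h & A (x i)]).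
  (* [p] is the common point of the block, and the coloring is its orbit map. *)
  right; pose p := gact (h^-1)%g (x i).
  have pA : A p by rewrite /p G_invariantE.
  pose f g : sub_gset HA := exist _ (gact g p) (mem_set (HA g pA)).
  have [d1 [EB Ez]] := @dowling_color G (sub_gset HA) n d b f bB.
  have fe : equivariant f by move=> g k; apply: val_inj; exact: gactM.
  have s1 : color_step d d1 by exists b, f.
  exists d1; split; [by right|split=> [j u|c]]; last first.
    by rewrite EB => /setD1P[_]; case: sx => _; apply.
  rewrite Ez; case bj : (b j) => [k|]; last exact: stratum_zero sx.
  by case=> <-; rewrite (stratum_block sx bB bi bj) gactM.
have [[a [b [i [j [g [h [k [aB bB ab [ai bj xij]]]]]]]]]|Nb] := pselect
    (exists a b i j g h k, [/\ proj_color a \in blocks d, proj_color b \in blocks d,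
      proj_color a != proj_color b & [/\ a i = Some h, b j = Some k & gact g (x i) = x j]]).
  (* The common points are [h^-1.x_i] and [k^-1.x_j]; since [g.x_i = x_j], the factor [k^-1 g h]
     takes the first to the second. *)
  right; have [d1 [EB Ez]] := @dowling_merge G _ n d a b (k^-1 * g * h)%g aB bB ab.
  exists d1; split; first by left; exists a, b, (k^-1 * g * h)%g.
  split=> [l u|c]; first by rewrite Ez; exact: stratum_zero.
  rewrite EB => /setU1P[|/setDP[cB _]]; last by case: sx => _; apply.
  move/esym/proj_color_eqP => [e ->]; exists (gact (e^-1 * h^-1)%g (x i)) => l q.
  case/color_mulrP=> r /color_unionP[al|[_ /color_mulrP[s bl ->]]] ->.
    by rewrite (stratum_block sx aB ai al) -gactM !mulgA mulgK.
  by rewrite (stratum_block sx bB bj bl) -xij -!gactM !mulgA mulgK mulgK.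
left; split=> // [i zi xA|b i j g h bB bi xij bj].
  by have [b [h [bB bi]]] := zero_color_None zi; apply: Nz; exists b, i, h.
(* If [j] were outside the block of [b], it would lie in another block, as [x j] is outside the
   invariant set [A]; the two blocks could then be merged. *)
have xiA : ~ A (x i) by move=> xA; apply: Nz; exists b, i, h.
have /zero_color_None[c [k [cB cj]]] : zero_color d j = None.
  case E : (zero_color d j) => [u|] //; case: xiA.
  by rewrite -(G_invariantE g _ HA) xij (stratum_zero sx E); exact: set_valP.
apply: Nb; exists b, c, i, j, g, h, k; split=> //; apply/eqP => bc.
by have [l] := proj_color_domain (esym bc) cj; rewrite bj.
Qed.

End Strata.

(** * Existence of generic points and connectedness of strata *)

Section GenericPoints.
Context (G : finGroupType) (X : gspace G) (n : nat).
Context (A : set (gspace_gset X)) (HA : G_invariant A).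
Hypothesis X_connected : connected_space X.
Implicit Types (d : dowling (sub_gset HA) n) (a b c : coloring G n).
Implicit Types (x y : 'I_n -> gspace_gset X) (W : set ('I_n -> gspace_gset X)).

(** The points are chosen one at a time, avoiding [A] and the finitely many translates of the points
    at hand. *)
Lemma generic_orbits (I : finType) : infinite_set [set: gspace_gset X] ->
  finite_set A -> exists p : I -> gspace_gset X,
    (forall e, ~ A (p e)) /\ (forall e e' g, gact g (p e) = p e' -> e = e').
Proof.
move=> Xinf Af.
suff [p [H1 H2]] : exists p : I -> gspace_gset X,
    (forall e, e \in enum I -> ~ A (p e)) /\
    (forall e e' g, e \in enum I -> e' \in enum I -> gact g (p e) = p e' -> e = e').
  exists p; split=> [e|e e' g]; first by apply: H1; rewrite mem_enum.
  by apply: H2; rewrite mem_enum.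
elim: (enum I) => [|e0 s [p [pA pO]]].
  by have [q _] := infinite_setN0 Xinf; exists (fun=> q).
pose B := A `|` [set gact q.1 (p q.2) | q in [set: G * I]].
have Bf : finite_set B.
  by rewrite finite_setU; split=> //; apply: finite_image; exact: finite_finset.
have [q /= qB] : exists q, ~ B q.
  have [q []] := infinite_setN0 (infinite_setD Xinf Bf); by exists q.
have qO g e : gact g (p e) <> q by move=> pe; apply: qB; right; exists (g, e).
exists (fun e => if e == e0 then q else p e); split=> [e|e e' g].
  by rewrite inE; case: eqP => [_ _ qA|_ /= /pA //]; apply: qB; left.
rewrite !inE; case: eqP => [->|_] /=; case: eqP => [->|_] //= es es' pe.
- by case: (qO (g^-1)%g e'); rewrite -pe gactK.
- by case: (qO g e).
- exact: pO pe.
Qed.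

(** Each block gets its own orbit outside [A]: with [r C] a chosen representative of the block [C],
    coordinate [i] is [h.(p C)] where [h] is the color of [i]. *)
Lemma generic_exists d : infinite_set [set: gspace_gset X] -> finite_set A ->
  exists x, generic d x.
Proof.
move=> Xinf Af.
have [p [pA pO]] := generic_orbits {set coloring G n} Xinf Af.
have /choice[r rE] (C : {set coloring G n}) :
    exists b, C \in blocks d -> C = proj_color b.
  have [CB|nC] := boolP (C \in blocks d); last by exists [ffun=> None].
  by have [b [_ [_ [-> _]]]] := dowling_block CB; exists b.
have /choice[x xE] i : exists q : gspace_gset X,
    (forall u, zero_color d i = Some u -> q = val u) /\
    (forall C h, C \in blocks d -> r C i = Some h -> q = gact h (p C)).
  case E : (zero_color d i) => [u|].
    exists (val u); split=> [_ [<-] //|C h CB ri].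
    have rB : proj_color (r C) \in blocks d by rewrite -rE.
    by rewrite (zero_color_block rB ri) in E.
  have [b [h [bB bi]]] := zero_color_None E.
  have [k ri] := proj_color_domain (rE _ bB) bi.
  exists (gact k (p (proj_color b))); split=> // C l CB rC.
  have CC : C = proj_color b.
    have rB : proj_color (r C) \in blocks d by rewrite -rE.
    by rewrite (rE _ CB); exact: dowling_block_eq rB bB rC bi.
  by move: rC; rewrite CC ri => -[->].
have xz i u : zero_color d i = Some u -> x i = val u by case: (xE i) => + _; apply.
have xb b i h : proj_color b \in blocks d -> b i = Some h ->
    exists k, x i = gact k (p (proj_color b)).
  move=> bB bi; have [k ri] := proj_color_domain (rE _ bB) bi.
  by exists k; case: (xE i) => _; apply.
have nA b i h : proj_color b \in blocks d -> b i = Some h -> ~ A (x i).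
  by move=> bB bi; have [k ->] := xb _ _ _ bB bi; rewrite G_invariantE.
exists x; split=> [|i zi|b i j g h bB bi xij].
- split=> // b bB; have /esym/proj_color_eqP[k bE] := rE _ bB.
  exists (gact (k^-1)%g (p (proj_color b))) => i h; rewrite bE => /color_mulrP[l ri ->].
  by rewrite -gactM mulgK -bE; case: (xE i) => _; apply=> //; rewrite -bE.
- by have [b [h [bB bi]]] := zero_color_None zi; exact: nA bB bi.
- have /zero_color_None[c [l [cB cj]]] : zero_color d j = None.
    case E : (zero_color d j) => [u|] //; case: (nA _ _ _ bB bi).
    by rewrite -(G_invariantE g _ HA) xij (xz _ _ E); exact: set_valP.
  have [k xi] := xb _ _ _ bB bi; have [m xj] := xb _ _ _ cB cj.
  have /pO bc : gact (m^-1 * g * k)%g (p (proj_color b)) = p (proj_color c).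
    by rewrite !gactM -xi xij xj gactK.
  by have [e ->] := proj_color_domain (esym bc) cj.
Qed.

Definition move_block b x (p : gspace_gset X) : 'I_n -> gspace_gset X :=
  fun i => if b i is Some h then gact h p else x i.

Lemma move_block_stratum d b x p : proj_color b \in blocks d -> stratum d x ->
  stratum d (move_block b x p).
Proof.
move=> bB [xz xb]; split=> [i u zi|c cB].
  rewrite /move_block; case bi : (b i) => [h|]; last exact: xz.
  by rewrite (zero_color_block bB bi) in zi.
have [/eqP/esym/proj_color_eqP[k ->]|cb] := boolP (proj_color c == proj_color b).
  exists (gact (k^-1)%g p) => i h /color_mulrP[l bi ->].
  by rewrite /move_block bi -gactM mulgK.
have [q qE] := xb _ cB; exists q => i h ci; rewrite /move_block -(qE _ _ ci).
by case bi : (b i) => [k|] //; rewrite (dowling_block_eq cB bB ci bi) eqxx in cb.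
Qed.

Lemma move_block_id d b x i h : proj_color b \in blocks d -> stratum d x ->
  b i = Some h -> move_block b x (gact (h^-1)%g (x i)) = x.
Proof.
move=> bB sx bi; apply/funext => j; rewrite /move_block.
by case bj : (b j) => [k|] //; rewrite -gactM (stratum_block sx bB bi bj).
Qed.

(** Induction on the number of coordinates at which [x] and [y] differ. Moving the block of such a
    coordinate to the common point it has in [y] makes the whole block agree with [y] and keeps the
    other coordinates. *)
Lemma stratum_component d W x y : stratum d `<=` W ->
  stratum d x -> stratum d y -> @power_component X n W x y.
Proof.
move=> dW; have [m] := ubnP #|[set i | ~~ `[< x i = y i >]]%SET|.
elim: m x => // m IHm x xm sx sy.
have [/existsP[i /asboolPn xyi]|/existsPn xy] := boolP [exists i, ~~ `[< x i = y i >]]; last first.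
  have -> : y = x by apply/funext => i; have /negPn/asboolP := xy i.
  exact/power_component_refl/dW.
have [b [h [bB bi]]] : exists b h, proj_color b \in blocks d /\ b i = Some h.
  apply: zero_color_None; case E : (zero_color d i) => [u|] //; case: xyi.
  by rewrite (stratum_zero sx E) (stratum_zero sy E).
pose f j := if b j is Some k then gact k else fun=> x j.
have fE p : f^~ p = move_block b x p.
  by apply/funext => j; rewrite /f /move_block; case: (b j).
apply: (@power_component_trans X n W x (move_block b x (gact (h^-1)%g (y i)))).
  (* The motion starts at [x], which is its value at the common point [h^-1.x_i]. *)
  rewrite -[X in power_component _ X](move_block_id bB sx bi) -!fE.
  apply: power_component_image => // [j|p].
    by rewrite /f; case: (b j) => [k|]; [left; exact: gspace_act_morphism|right; exists (x j)].
  by rewrite fE; apply/dW/move_block_stratum.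
apply: IHm => //; last exact: move_block_stratum.
rewrite ltnS in xm; apply: leq_trans xm; apply: proper_card; apply/properP; split.
  apply/fintype.subsetP => j; rewrite !inE; apply: contraNN => /asboolP xyj; apply/asboolP.
  rewrite /move_block; case bj : (b j) => [k|] //.
  by rewrite -gactM -(stratum_block sy bB bi bj).
exists i; rewrite !inE; first exact/asboolPn.
by rewrite negbK /move_block bi; apply/asboolP; rewrite -gactM mulgV gact1.
Qed.

End GenericPoints.

(** * Layers *)

Section LayerStrata.
Context (G : finGroupType) (X : gspace G) (n : nat).
Context (T : set (gspace_gset X)) (T_invariant : G_invariant T).
Local Notation S := (@Sing G (gspace_gset X)).
Local Notation A := (T `|` S).
Let HA : G_invariant A :=
  invariant_setU T_invariant (@Sing_invariant G (gspace_gset X)).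
Hypothesis X_connected : connected_space X.
Hypothesis A_finite : finite_set A.
Implicit Types (d : dowling (sub_gset HA) n) (a b c : coloring G n).
Implicit Types (x y : 'I_n -> gspace_gset X).

Let Sing_A : S `<=` A. Proof. by right. Qed.

(* The zero block consists of the coordinates that stay in [T `|` S] on all of
   the intersection; any other coordinate takes a free value there, so it is
   related to another one by at most one group element. *)
Lemma layer_stratum (F : set (set ('I_n -> gspace_gset X))) x0 :
  F `<=` @arrangement G X T n -> (\bigcap_(H in F) H) x0 ->
  exists d, @power_component X n (\bigcap_(H in F) H) x0 = stratum d.
Proof.
set W := \bigcap_(H in F) H => FA Wx0.
pose pinned i := forall x, W x -> A (x i).
pose rel i j g := forall x, W x -> gact g (x i) = x j.
have rel_pinned i j g : rel i j g -> pinned i <-> pinned j.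
  by move=> ij; split=> H x Wx; have := H x Wx; rewrite -(ij x Wx) G_invariantE.
have rel_uniq i j g h : ~ pinned i -> rel i j g -> rel i j h -> g = h.
  move=> /existsNP[x /not_implyP[Wx xA]] ig ih.
  by apply: (free_outside Sing_A xA); rewrite ig // ih.
(* The block of [i], normalized to have color 1 at [i]; the element picked is unique if [i] is not
   pinned. *)
pose col i : coloring G n := [ffun j => [pick g | `[< rel i j g >]]].
have colP i j g : ~ pinned i -> col i j = Some g <-> rel i j g.
  move=> ip; rewrite ffunE; case: pickP => [h /asboolP ih|N].
    by split=> [[<-] //|ig]; rewrite (rel_uniq _ _ _ _ ip ih ig).
  by split=> // /asboolP; rewrite N.
have col_rel i j g : col i j = Some g -> rel i j g.
  by rewrite ffunE; case: pickP => // h /asboolP ih [<-].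
have rel1 i : rel i i 1%g by move=> x _; rewrite gact1.
have relM i j l g h : rel i j g -> rel j l h -> rel i l (h * g)%g.
  by move=> ij jl x Wx; rewrite gactM ij // jl.
have relV i j g : rel i j g -> rel j i (g^-1)%g.
  by move=> ij x Wx; rewrite -(ij x Wx) gactK.
pose B := [set proj_color (col i) | i in [pred i | ~~ `[< pinned i >]]]%SET.
have BP C : C \in B -> exists2 i, ~ pinned i & C = proj_color (col i).
  by case/imsetP => i; rewrite inE => /asboolPn ip ->; exists i.
have colB i : ~ pinned i -> proj_color (col i) \in B.
  by move=> ip; apply: imset_f; rewrite inE; exact/asboolPn.
(* Pinned coordinates are constant on the component, so the base point gives their values. *)
pose z : {ffun 'I_n -> option (sub_gset HA)} := [ffun i =>
  if pselect (pinned i) is left ip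
  then Some (exist _ (x0 i) (mem_set (ip _ Wx0)) : A) else None].
have zP i u : z i = Some u -> pinned i /\ x0 i = val u.
  by rewrite ffunE; case: pselect => // ip [<-].
have zN i : z i = None <-> ~ pinned i by rewrite ffunE; case: pselect.
have [C /BP[i ip ->]|b c i h k bB cB bi ci|b i h bB bi|i|d [dB dz]] :=
    @dowling_build G (sub_gset HA) n B z.
- by exists (col i), i, 1%g; split=> //; exact/colP.
- have [j jp bj] := BP _ bB; have [l lp cl] := BP _ cB; rewrite bj cl.
  have [p jip] := proj_color_domain bj bi.
  have [q liq] := proj_color_domain cl ci.
  (* Through the common index [i], the indices [j] and [l] are related, so the two normalized
     colorings differ by the factor [p^-1 q]. *)
  move: jip liq => /col_rel ji /col_rel li; have jl := relM _ _ _ _ _ ji (relV _ _ _ li).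
  apply/proj_color_eqP; exists (p^-1 * q)%g; apply/ffunP => m.
  case E : (color_mulr (col j) (p^-1 * q)%g m) => [e|].
    move/color_mulrP: E => [r /col_rel jm ->]; apply/colP => //.
    have := relM _ _ _ _ _ (relV _ _ _ jl) jm.
    by rewrite invMg invgK.
  case E' : (col l m) => [e|] //; move/col_rel: E' => lm.
  have /(colP _ _ _ jp) jm := relM _ _ _ _ _ jl lm.
  by move: E; rewrite ffunE jm.
- have [j jp bj] := BP _ bB; have [p /col_rel ji] := proj_color_domain bj bi.
  by apply/zN; rewrite -(rel_pinned _ _ _ ji).
- by move=> /zN ip; exists (col i), 1%g; split; [exact: colB|exact/colP].
have comp_sub y : @power_component X n W x0 y -> stratum d y.
  move=> x0y; have Wy := power_component_sub x0y; split=> [i u|b].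
    rewrite dz => /zP[ip <-].
    exact: (power_component_discrete A_finite ip Wx0 x0y).
  rewrite dB => /BP[j jp /esym/proj_color_eqP[k ->]].
  exists (gact (k^-1)%g (y j)) => i h /color_mulrP[l /col_rel ji ->].
  by rewrite -gactM mulgK ji.
(* A member of [F] relating unpinned coordinates is built into the blocks; any other constrains
   pinned coordinates only, which keep their values at [x0]. *)
have sub_W : stratum d `<=` W.
  move=> y sy H FH; have WH : W `<=` H by move=> x; apply.
  have pin i : pinned i -> y i = x0 i.
    move=> ip; case E : (z i) => [u|]; last by move/zN: E.
    by have [_ ->] := zP _ _ E; apply: (stratum_zero sy); rewrite dz.
  case: (FA _ FH) => [[i [j [g [_ EH]]]]|[i [t [Tt EH]]]]; rewrite EH.
    have ij : rel i j g by move=> x /WH; rewrite EH.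
    rewrite /diag_subspace /=; have [ip|ip] := pselect (pinned i).
      by rewrite (pin _ ip) (pin _ ((rel_pinned _ _ _ ij).1 ip)); exact: ij.
    have ciB : proj_color (col i) \in blocks d by rewrite dB; exact: colB.
    rewrite (@stratum_block _ _ _ _ _ d y (col i) i j 1%g g) ?invg1 ?mulg1 //.
      exact/colP.
    exact/colP.
  have it x : W x -> x i = t by move=> /WH; rewrite EH.
  rewrite /point_subspace /= pin ?it // => x Wx; rewrite it //; by left.
exists d; apply/seteqP; split=> // y sy; apply: (stratum_component X_connected sub_W) => //.
apply: comp_sub; exact: power_component_refl.
Qed.

Definition range_condition d : Prop :=
  forall o, (G_orbits S `\` G_orbits T) o -> #|zero_fiber d o| <> 1%N.

Lemma G_orbit_refl (p : gspace_gset X) : G_orbit p p.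
Proof. by exists 1%g => //; rewrite gact1. Qed.

Lemma G_orbit_act (o : set (gspace_gset X)) (B : set (gspace_gset X)) g p :
  G_orbits B o -> o (gact g p) <-> o p.
Proof.
case=> q _ <-; split=> -[h _ hq].
  by exists (g^-1 * h)%g => //; rewrite gactM hq gactK.
by exists (g * h)%g => //; rewrite gactM hq.
Qed.

Lemma G_orbits_meet (o : set (gspace_gset X)) (B C : set (gspace_gset X)) p :
  G_orbits B o -> o p -> C p -> G_orbits C o.
Proof.
case=> q _ <- [g _ <-] Cp; exists (gact g q) => //.
apply/seteqP; split=> _ [h _ <-].
  by exists (h * g)%g => //; rewrite gactM.
by exists (h * g^-1)%g => //; rewrite gactM gactK.
Qed.

Lemma zero_fiberP d o i :
  reflect (exists2 u, zero_color d i = Some u & o (val u)) (i \in zero_fiber d o).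
Proof. by rewrite inE; exact: asboolP. Qed.

Hypothesis X_infinite : infinite_set [set: gspace_gset X].

Lemma stratum_layer d : range_condition d -> @is_layer G X T n (stratum d).
Proof.
move=> dR; have [x gx] := generic_exists d X_infinite A_finite.
have [sx _ _] := gx.
pose F := [set H | @arrangement G X T n H /\ stratum d `<=` H].
have FA : F `<=` @arrangement G X T n by move=> H [].
have dW : stratum d `<=` \bigcap_(H in F) H by move=> y sy H [_]; apply.
exists F => //; exists x; first exact: dW.
(* The arrangement has diagonals for [i < j] only; the other order is reached through [g^-1]. *)
have diagW i j g y : i <> j -> (forall x, stratum d x -> gact g (x i) = x j) ->
    (\bigcap_(H in F) H) y -> gact g (y i) = y j.
  move=> ij H Wy; have [lij|lji|/val_inj //] := ltngtP i j.
    by apply: (Wy (diag_subspace i j g)); split=> //; left; exists i, j, g.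
  suff <- : gact (g^-1)%g (y j) = y i by rewrite -gactM mulgV gact1.
  apply: (Wy (diag_subspace j i (g^-1)%g)); split; first by left; exists j, i, (g^-1)%g.
  by move=> z sz; apply: etrans (gactK g (z i)); rewrite (H _ sz).
apply/seteqP; split=> [y sy|y xy]; first exact: (stratum_component X_connected dW).
have Wy := power_component_sub xy; split=> [i u zi|b bB]; last first.
  have [c [i [h [bc ci]]]] := dowling_block bB; have [k bi] := proj_color_domain (esym bc) ci.
  exists (gact (k^-1)%g (y i)) => j l bj; rewrite -gactM.
  have [ji|/eqP ij] := eqVneq j i.
    by move: bj; rewrite ji bi => -[->]; rewrite mulgV gact1.
  apply/esym/diagW => //; first exact/nesym.
  by move=> z sz; rewrite (stratum_block sz bB bi bj).
have xi : x i = val u := stratum_zero sx zi.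
have [uT|uT] := pselect (T (val u)).
  apply: (Wy (point_subspace i (val u))); split; first by right; exists i, (val u).
  by move=> z sz; exact: stratum_zero sz zi.
have uS : S (val u) by case: (set_valP u).
rewrite -xi; apply: (power_component_discrete (sub_finite_set Sing_A A_finite) _ _ xy);
  last exact: dW.
move=> {y xy Wy} y Wy.
have oS : G_orbits S (G_orbit (val u)) by exists (val u).
have oT : ~ G_orbits T (G_orbit (val u)).
  case=> t Tt ou; apply: uT; have : G_orbit t (val u) by rewrite ou; exact: G_orbit_refl.
  by case=> g _ <-; exact: T_invariant.
have i0 : i \in zero_fiber d (G_orbit (val u)).
  by apply/zero_fiberP; exists u => //; exact: G_orbit_refl.
have [j /zero_fiberP[v zj [g _ gv]] ji] :
    exists2 j, j \in zero_fiber d (G_orbit (val u)) & j <> i.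
  apply: contrapT => N; apply: (dR _ (conj oS oT)); apply/eqP/cards1P; exists i.
  apply/setP => j; rewrite finset.in_set1; apply/idP/eqP => [j0|-> //].
  by apply: contrapT => ji; apply: N; exists j.
(* Both [g] and [g k] take [u] to [v], so both relate coordinates [i] and [j] on the intersection.
   Hence [k] fixes [y i], which is confined to the finite set [S]. *)
have [k /= k1 ku] := uS.
have ij h : gact h (val u) = val v -> gact h (y i : gspace_gset X) = y j.
  move=> huv; apply: diagW => [ij||//]; first by apply: ji.
  by move=> z sz; rewrite (stratum_zero sz zi) (stratum_zero sz zj).
exists k => //; rewrite /fixed_points /=.
have := ij (g * k)%g; rewrite gactM ku => /(_ gv).
by rewrite -(ij _ gv) gactM => /(congr1 (gact (g^-1)%g)); rewrite !gactK.
Qed.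

Hypothesis X_nontrivial : exists p q : gspace_gset X, p <> q.

(** If [i] is the only index in the orbit [o], no member of [F] involves coordinate [i] at a generic
    point [x]: a diagonal would put a second coordinate in [o], and a point subspace would make [o]
    an orbit of [T]. Coordinate [i] then runs over all of the space within the layer, although the
    stratum fixes it. *)
Lemma layer_range_condition d : @is_layer G X T n (stratum d) -> range_condition d.
Proof.
case=> F FA [x0 Wx0 dE] o [oS oT] /eqP/cards1P[i o1].
have [x gx] := generic_exists d X_infinite A_finite; have [sx _ _] := gx.
have x0x : @power_component X n (\bigcap_(H in F) H) x0 x by rewrite -dE.
have Wx := power_component_sub x0x.
have /zero_fiberP[u zi ou] : i \in zero_fiber d o by rewrite o1 set11.
have xi := stratum_zero sx zi.
have oi j : o (x j) -> j = i.
  move=> oj; apply/set1P; rewrite -o1.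
  have [|v zj xj] := generic_zero gx (i := j).
    by have [s Ss so] := oS; move: oj; rewrite -so => -[g _ <-]; right; exact: Sing_invariant.
  by apply/zero_fiberP; exists v => //; rewrite -xj.
(* The identity is written as the action of 1, which is known to be a morphism. *)
pose f j : gspace_gset X -> gspace_gset X := if j == i then gact 1%g else fun=> x j.
have fi p : f i p = p by rewrite /f eqxx gact1.
have fj j p : j <> i -> f j p = x j by rewrite /f => /eqP/negbTE ->.
have fW p : (\bigcap_(H in F) H) (f^~ p).
  move=> H FH; have := Wx _ FH; case: (FA _ FH) => [[a [b [g [ab ->]]]]|[a [t [Tt ->]]]].
    change (gact g (x a) = x b -> gact g (f a p) = f b p) => xab.
    have ai : a <> i.
      move=> ai; have bi : b = i by apply: oi; rewrite -xab ai xi (G_orbit_act _ _ oS).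
      by rewrite ai bi ltnn in ab.
    have bi : b <> i.
      by move=> bi; apply: ai; apply: oi; rewrite -(G_orbit_act g _ oS) xab bi xi.
    by rewrite !fj.
  rewrite /point_subspace /= => xa; rewrite fj // => ai.
  by apply: oT; apply: (G_orbits_meet oS ou); rewrite -xi -ai xa.
have const p : p = val u.
  rewrite -(fi p); apply: (@stratum_zero _ _ _ _ _ d (f^~ p) i u) => //; rewrite dE.
  apply: power_component_trans x0x _.
  have <- : f^~ (x i) = x.
    by apply/funext => j; have [->|/eqP ji] := eqVneq j i; [rewrite fi|rewrite fj].
  apply: power_component_image => // j; rewrite /f; case: eqP => _.
    by left; exact: gspace_act_morphism.
  by right; exists (x j).
by have [p [q]] := X_nontrivial; rewrite (const p) (const q).
Qed.

Lemma stratum_mono d d' : stratum d' `<=` stratum d <-> dowling_le d d'.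
Proof.
split=> [dd'|]; last exact: stratum_le.
have [x gx] := generic_exists d' X_infinite A_finite.
by apply: (generic_le Sing_A gx); apply: dd'; case: gx.
Qed.

Lemma stratum_inj d d' : stratum d = stratum d' -> d = d'.
Proof. by move=> e; apply: dowling_le_anti; apply/stratum_mono; rewrite e. Qed.

End LayerStrata.

(** * The wreath product action *)

Section Wreath.
Context (G : finGroupType) (X : gspace G) (n : nat) (w : wreath n G).
Context (A : set (gspace_gset X)) (HA : G_invariant A).
Implicit Types (d : dowling (sub_gset HA) n).

Lemma wreath_act_perm (x : 'I_n -> gspace_gset X) i :
  wreath_act w x (w.2 i) = gact (w.1 i) (x i).
Proof. by rewrite /wreath_act permK. Qed.

Lemma wreath_color_perm (b : coloring G n) i :
  wreath_color w b (w.2 i) = omap (fun h => (w.1 i * h)%g) (b i).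
Proof. by rewrite ffunE /= permK. Qed.

Lemma zero_color_wreath d i :
  zero_color (wreath_dowling w d) (w.2 i) = omap (gact (w.1 i)) (zero_color d i).
Proof. by rewrite ffunE /= permK. Qed.

Lemma stratum_wreath d :
  stratum (wreath_dowling w d) = wreath_act w @` stratum d.
Proof.
apply/seteqP; split=> [y [yz yb]|_ [x [xz xb] <-]].
  (* The image of [y] under the inverse of [w]. *)
  exists (fun i => gact (w.1 i)^-1%g (y (w.2 i))); last first.
    have K j : gact (w.1 j) (gact (w.1 j)^-1%g (y (w.2 j))) = y (w.2 j).
      by rewrite -gactM mulgV gact1.
    by apply/funext => i; rewrite -[i](permKV w.2) wreath_act_perm; exact: K.
  split=> [i u zi|b bB].
    by rewrite (yz _ (gact (w.1 i) u)) ?zero_color_wreath ?zi //; exact: gactK.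
  have [|p pE] := yb (wreath_color w b).
    by rewrite -wreath_color_proj; exact: imset_f.
  exists p => i h bi; rewrite (pE _ (w.1 i * h)%g) ?wreath_color_perm ?bi //.
  by rewrite gactM gactK.
split=> [i u|b].
  rewrite -[i](permKV w.2) zero_color_wreath wreath_act_perm.
  case E : (zero_color d _) => [v|] //= [<-]; by rewrite (xz _ _ E).
case/imsetP => C CB; have [c [_ [_ [EC _]]]] := dowling_block CB.
rewrite EC wreath_color_proj => /esym/proj_color_eqP[k ->].
rewrite EC in CB; have [p pE] := xb _ CB.
exists (gact (k^-1)%g p) => i h /color_mulrP[l + ->].
rewrite -[i](permKV w.2) wreath_color_perm wreath_act_perm.
case E : (c _) => [m|] // [<-]; rewrite (pE _ _ E) -!gactM.
by rewrite mulgK.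
Qed.

(** Orbits are stable under the action, so [w.2] carries one fibre onto the other. Hence the range
    condition is invariant. *)
Lemma card_zero_fiber_wreath d (B o : set (gspace_gset X)) : G_orbits B o ->
  #|zero_fiber (wreath_dowling w d) o| = #|zero_fiber d o|.
Proof.
move=> oB; rewrite -(card_preimset _ (@perm_inj _ w.2)); apply: eq_card => i.
rewrite !inE; apply: asbool_equiv_eq; rewrite zero_color_wreath.
split=> [[u]|[u -> ou]]; last first.
  exists (@gact G (sub_gset HA) (w.1 i) u) => //.
  exact: (G_orbit_act (w.1 i) (val u) oB).2 ou.
case E : (zero_color d i) => [v|] // [<-] ov; exists v => //.
exact: (G_orbit_act (w.1 i) (val v) oB).1 ov.
Qed.

End Wreath.

Theorem theorem3p15 (G : finGroupType) (X : gspace G)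
    (X_connected : connected_space X)
    (X_nontrivial : exists x y : gspace_gset X, x <> y)
    (S_finite : finite_set (@Sing G (gspace_gset X)))
    (T : set (gspace_gset X)) (T_finite : finite_set T)
    (T_invariant : G_invariant T) (n : nat) :
  let S := @Sing G (gspace_gset X) in
  let TS_invariant : G_invariant (T `|` S) :=
    invariant_setU T_invariant (@Sing_invariant G (gspace_gset X)) in
  exists phi : layer T n -> dowling (sub_gset TS_invariant) n,
    [/\ poset_embedding (@layer_le G X T n)
          (@dowling_le G (sub_gset TS_invariant) n) phi,
        wreath_equivariant phi,
        natural_map phi &
        range phi = [set d | forall o, (G_orbits S `\` G_orbits T) o ->
                               #|zero_fiber d o| <> 1%N]].
Proof.
move=> S TS.
have A_finite : finite_set (T `|` S) by rewrite finite_setU.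
have X_infinite : infinite_set [set: gspace_gset X].
  exact: connected_space_infinite X_connected X_nontrivial.
have /choice[phi phiE] (L : layer T n) :
    exists d : dowling (sub_gset TS) n, layer_set L = stratum d.
  case: L => L0 [F FA [x0 Fx0 L0E]]; rewrite /layer_set /= L0E.
  exact: (layer_stratum T_invariant X_connected A_finite FA Fx0).
have layer_inj (L L' : layer T n) : layer_set L = layer_set L' -> L = L'.
  by case: L L' => [L pL] [L' pL'] /= e; exact: eq_exist.
have st_inj := @stratum_inj G X n T T_invariant A_finite X_infinite.
have st_mono := @stratum_mono G X n T T_invariant A_finite X_infinite.
have phi_range d : range_condition d -> exists2 L, phi L = d & layer_set L = stratum d.
  move=> dR; have dL := stratum_layer X_connected A_finite X_infinite dR.
  pose L : layer T n := exist _ (stratum d) dL.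
  by exists L => //; apply: st_inj; rewrite -phiE.
have range_phi L : range_condition (phi L).
  apply: (layer_range_condition X_connected A_finite X_infinite X_nontrivial).
  by rewrite -phiE; exact: proj2_sig L.
exists phi; split.
- split=> [L L' e|L L']; first by apply: layer_inj; rewrite !phiE e.
  by rewrite /layer_le !phiE; exact: st_mono.
(* The translated datum still satisfies the range condition, so it comes from a layer, which is the
   translate of [L] by [stratum_wreath]. *)
- move=> w L; have [|L' phiL' L'E] := phi_range (wreath_dowling w (phi L)).
    move=> o oST; rewrite (card_zero_fiber_wreath w _ oST.1).
    exact: range_phi.
  by exists L' => //; rewrite L'E stratum_wreath phiE.
- exact: phiE.
- apply/seteqP; split=> [_ [L _ <-]|d /phi_range[L <- _]]; last by exists L.
  exact: range_phi.
Qed.
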